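(* Let $\mathbb{F}$ be a field, $q\in\mathbb{F}$ and $f,g\in\mathbb{F}[h]$. The quantum generalized Heisenberg algebra $\mathcal{H}_q(f,g)$ is a domain if and only if $q\neq 0$ and $\deg f\geq 1$.
   Context: $\mathcal{H}_q(f,g)$ is the unital associative $\mathbb{F}$-algebra generated by $x,y,h$ with defining relations $hx=xf(h)$, $yh=f(h)y$, $yx-qxy=g(h)$. A domain is a (not necessarily commutative) nonzero ring without nonzero left or right zero divisors. *)

(* Defs.v *)
From HB Require Import structures.
From mathcomp Require Import all_boot all_order all_algebra.
From mathcomp Require Import generic_quotient ring_quotient.
From mathcomp Require Import boolp.
From mathcomp Require Import monalg.

Set Implicit Arguments.
Unset Strict Implicit.
Unset Printing Implicit Defensive.

Import GRing.Theory.
Local Open Scope ring_scope.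
Local Open Scope quotient_scope.

Definition left_zero_divisor (R : pzRingType) (a : R) : Prop :=
  exists2 b : R, b != 0 & a * b = 0.

Definition right_zero_divisor (R : pzRingType) (a : R) : Prop :=
  exists2 b : R, b != 0 & b * a = 0.

(* Commutativity is not required, unlike in idomainType. *)
Definition is_domain (R : pzRingType) : Prop :=
  1 != 0 :> R /\
  forall a : R, a != 0 -> ~ left_zero_divisor a /\ ~ right_zero_divisor a.

Section TwoSidedQuotient.
Variables (F : fieldType) (A : algType F) (S : seq A).

(* The finite sums of elements a * s * b with s in S, i.e. the two-sided ideal
   generated by S. *)
Inductive in_ideal_gen : A -> Prop :=
| in_ideal_gen0 : in_ideal_gen 0
| in_ideal_genD a s b c :
    s \in S -> in_ideal_gen c -> in_ideal_gen (a * s * b + c).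

Definition ideal_gen : {pred A} := fun a => `[< in_ideal_gen a >].

Lemma ideal_genD a b : in_ideal_gen a -> in_ideal_gen b -> in_ideal_gen (a + b).
Proof.
move=> + Ib; elim=> [|a1 s b1 c Ss _ IH]; first by rewrite add0r.
by rewrite -addrA; apply: in_ideal_genD.
Qed.

Lemma ideal_genMl x a : in_ideal_gen a -> in_ideal_gen (x * a).
Proof.
elim=> [|a1 s b1 c Ss _ IH]; first by rewrite mulr0; apply: in_ideal_gen0.
by rewrite mulrDr !mulrA; apply: in_ideal_genD.
Qed.

Lemma ideal_genMr x a : in_ideal_gen a -> in_ideal_gen (a * x).
Proof.
elim=> [|a1 s b1 c Ss _ IH]; first by rewrite mul0r; apply: in_ideal_gen0.
by rewrite mulrDl -[_ * b1 * x]mulrA; apply: in_ideal_genD.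
Qed.

Lemma ideal_gen_mem s : s \in S -> in_ideal_gen s.
Proof.
move=> Ss; rewrite -[s]addr0 -[s in s + _]mul1r -[1 * s]mulr1.
exact: in_ideal_genD Ss in_ideal_gen0.
Qed.

Fact ideal_gen_zmod_closed : zmod_closed ideal_gen.
Proof.
split=> [|a b /asboolP Ia /asboolP Ib]; apply/asboolP.
  exact: in_ideal_gen0.
by apply: ideal_genD => //; rewrite -mulN1r; apply: ideal_genMl.
Qed.

HB.instance Definition _ :=
  GRing.isZmodClosed.Build A ideal_gen ideal_gen_zmod_closed.

Definition quot_gen : Type := Quotient.quot ideal_gen.

HB.instance Definition _ := GRing.Zmodule.on quot_gen.
HB.instance Definition _ := Choice.on quot_gen.
HB.instance Definition _ : EqQuotient A (Quotient.equiv ideal_gen) quot_gen :=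
  EqQuotient.on quot_gen.

Definition quot_pi (a : A) : quot_gen := \pi_quot_gen a.

Lemma quot_piP a b : quot_pi a = quot_pi b <-> in_ideal_gen (a - b).
Proof.
have := Quotient.idealrBE ideal_gen a b; rewrite /quot_pi => E; split.
  by move/eqP; rewrite -E => /asboolP.
by move=> Iab; apply/eqP; rewrite -E; apply/asboolP.
Qed.

Lemma quot_pi_repr (u : quot_gen) : quot_pi (repr u) = u.
Proof. exact: reprK. Qed.

Lemma quot_gen_ind (P : quot_gen -> Prop) :
  (forall a, P (quot_pi a)) -> forall u, P u.
Proof. by move=> H u; rewrite -[u]quot_pi_repr. Qed.

Lemma quot_piB : {morph quot_pi : a b / a - b}.
Proof. by move=> a b; rewrite /quot_pi !piE. Qed.

HB.instance Definition _ := GRing.isZmodMorphism.Build A quot_gen quot_pi quot_piB.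

Definition quot_one : quot_gen := quot_pi 1.
(* Locked: otherwise failing unifications between products are very slow. *)
Definition quot_mul : quot_gen -> quot_gen -> quot_gen :=
  locked (fun u v => quot_pi (repr u * repr v)).
Definition quot_scale (k : F) (u : quot_gen) : quot_gen := quot_pi (k *: repr u).

Lemma quot_piM_def a b : quot_pi (a * b) = quot_mul (quot_pi a) (quot_pi b).
Proof.
have D x : in_ideal_gen (x - repr (quot_pi x)).
  by apply/quot_piP; rewrite quot_pi_repr.
rewrite /quot_mul -lock; apply/quot_piP; set a' := repr _; set b' := repr _.
have -> : a * b - a' * b' = (a - a') * b + a' * (b - b').
  by rewrite mulrBl mulrBr addrA subrK.
by apply: ideal_genD; [apply: ideal_genMr | apply: ideal_genMl].
Qed.

Lemma quot_piZ_def k a : quot_pi (k *: a) = quot_scale k (quot_pi a).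
Proof.
apply/quot_piP; rewrite -scalerBr -mulr_algl; apply: ideal_genMl.
by apply/quot_piP; rewrite quot_pi_repr.
Qed.

Fact quot_mulA : associative quot_mul.
Proof.
elim/quot_gen_ind=> a; elim/quot_gen_ind=> b; elim/quot_gen_ind=> c.
by rewrite -!quot_piM_def mulrA.
Qed.

Fact quot_mul1 : left_id quot_one quot_mul.
Proof. by elim/quot_gen_ind=> a; rewrite -quot_piM_def mul1r. Qed.

Fact quot_mulr1 : right_id quot_one quot_mul.
Proof. by elim/quot_gen_ind=> a; rewrite -quot_piM_def mulr1. Qed.

Fact quot_mulDl : left_distributive quot_mul +%R.
Proof.
elim/quot_gen_ind=> a; elim/quot_gen_ind=> b; elim/quot_gen_ind=> c.
by rewrite -raddfD -!quot_piM_def mulrDl raddfD.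
Qed.

Fact quot_mulDr : right_distributive quot_mul +%R.
Proof.
elim/quot_gen_ind=> a; elim/quot_gen_ind=> b; elim/quot_gen_ind=> c.
by rewrite -raddfD -!quot_piM_def mulrDr raddfD.
Qed.

HB.instance Definition _ := GRing.Zmodule_isPzRing.Build quot_gen
  quot_mulA quot_mul1 quot_mulr1 quot_mulDl quot_mulDr.

Fact quot_scaleA a b u : quot_scale a (quot_scale b u) = quot_scale (a * b) u.
Proof. by elim/quot_gen_ind: u => x; rewrite -!quot_piZ_def scalerA. Qed.

Fact quot_scale1 : left_id 1 quot_scale.
Proof. by elim/quot_gen_ind=> a; rewrite -quot_piZ_def scale1r. Qed.

Fact quot_scaleDr : right_distributive quot_scale +%R.
Proof.
move=> k; elim/quot_gen_ind=> a; elim/quot_gen_ind=> b.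
by rewrite -raddfD -!quot_piZ_def scalerDr raddfD.
Qed.

Fact quot_scaleDl u : {morph quot_scale^~ u : a b / a + b}.
Proof.
by elim/quot_gen_ind: u => x a b; rewrite -!quot_piZ_def scalerDl raddfD.
Qed.

HB.instance Definition _ := GRing.Zmodule_isLmodule.Build F quot_gen
  quot_scaleA quot_scale1 quot_scaleDr quot_scaleDl.

Lemma quot_piM : {morph quot_pi : a b / a * b}.
Proof. exact: quot_piM_def. Qed.

Lemma quot_pi1 : quot_pi 1 = 1.
Proof. by []. Qed.

Lemma quot_piZ k : {morph quot_pi : a / k *: a}.
Proof. by move=> a; apply: quot_piZ_def. Qed.

Lemma quot_scaleAl k (u v : quot_gen) : k *: (u * v) = (k *: u) * v.
Proof.
elim/quot_gen_ind: u => a; elim/quot_gen_ind: v => b.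
by rewrite -quot_piM -!quot_piZ -quot_piM scalerAl.
Qed.

Lemma quot_scaleAr k (u v : quot_gen) : k *: (u * v) = u * (k *: v).
Proof.
elim/quot_gen_ind: u => a; elim/quot_gen_ind: v => b.
by rewrite -quot_piM -!quot_piZ -quot_piM scalerAr.
Qed.

End TwoSidedQuotient.

Section FreeAlgebra.
Variable F : fieldType.

Definition free_alg : Type := {malg F[{fmonom 'I_3}]}.

HB.instance Definition _ := GRing.Lalgebra.on free_alg.

Fact free_scaleAr k (a b : free_alg) : k *: (a * b) = a * (k *: b).
Proof.
have kC (c : {malg F[{fmonom 'I_3}]}) : k%:MP * c = c * k%:MP.
  rewrite mul_malgC [RHS]malgM_def fgmulgU [LHS](monalgEw (msuppZ_le _ _)).
  by apply: eq_bigr => m _; rewrite mcoeffZ mulrC mulm1.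
by rewrite -[k *: (_ * _)]mul_malgC -[k *: b]mul_malgC mulrA kC mulrA.
Qed.

HB.instance Definition _ := GRing.Lalgebra_isAlgebra.Build F free_alg free_scaleAr.

Definition free_gen (i : 'I_3) : free_alg := << fmu i >>.

End FreeAlgebra.

Section QGHA.
Variables (F : fieldType) (q : F) (f g : {poly F}).

Definition free_x : free_alg F := free_gen F 0.
Definition free_y : free_alg F := free_gen F 1.
Definition free_h : free_alg F := free_gen F 2%:R.

Definition free_poly (p : {poly F}) : free_alg F := horner_alg free_h p.

Definition qgha_rels : seq (free_alg F) :=
  [:: free_h * free_x - free_x * free_poly f;
      free_y * free_h - free_poly f * free_y;
      free_y * free_x - q *: (free_x * free_y) - free_poly g].

Definition qgha : Type := quot_gen qgha_rels.

HB.instance Definition _ := GRing.PzRing.on qgha.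
HB.instance Definition _ := GRing.Lmodule.on qgha.

(* The algebra is never trivial: it acts on sequences F^nat, with h acting as
   the diagonal operator of eigenvalues hval 0, hval 1, ..., x as the shift and
   y as the weighted backward shift of weights yval 1, yval 2, ... *)
Definition hval (i : nat) : F := iter i (horner f) 0.
Fixpoint yval (i : nat) : F :=
  if i is j.+1 then q * yval j + g.[hval j] else 0.

Definition gen_act (a : 'I_3) (v : nat -> F) (i : nat) : F :=
  if a == 0 then (if i is j.+1 then v j else 0)
  else if a == 1 then yval i.+1 * v i.+1
  else hval i * v i.

Definition word_act (s : seq 'I_3) (v : nat -> F) : nat -> F :=
  foldr gen_act v s.

Definition act (p : free_alg F) (v : nat -> F) (i : nat) : F :=
  mmap idfun (fun m : {fmonom 'I_3} => word_act m v i) p.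

Lemma actB p r v i : act (p - r) v i = act p v i - act r v i.
Proof. exact: (mmapB (f := idfun)). Qed.

Lemma act0 v i : act 0 v i = 0.
Proof. exact: (mmap0 (f := idfun)). Qed.

Lemma actD p r v i : act (p + r) v i = act p v i + act r v i.
Proof. exact: (mmapD (f := idfun)). Qed.

Lemma actU c m v i : act << c *g m >> v i = c * word_act m v i.
Proof. exact: (mmapU (f := idfun)). Qed.

Lemma act_sum (I : Type) (r : seq I) (P : I -> free_alg F) v i :
  act (\sum_(j <- r) P j) v i = \sum_(j <- r) act (P j) v i.
Proof.
by elim: r => [|j r IH]; rewrite ?big_nil ?act0 // !big_cons actD IH.
Qed.

Lemma eq_word_act s v w : v =1 w -> word_act s v =1 word_act s w.
Proof.
move=> vw; elim: s => //= a s IH i; rewrite /gen_act.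
by case: i => [|i]; rewrite !IH.
Qed.

Lemma eq_act p v w : v =1 w -> act p v =1 act p w.
Proof.
by move=> vw i; apply: eq_bigr => m _; congr (_ * _); apply: eq_word_act.
Qed.

Lemma word_act_sum (I : Type) (r : seq I) (c : I -> F) (u : I -> nat -> F) s i :
  word_act s (fun k => \sum_(j <- r) c j * u j k) i
  = \sum_(j <- r) c j * word_act s (u j) i.
Proof.
elim: s i => //= a s IH i; rewrite /gen_act.
case: (a == 0).
  by case: i => [|i]; rewrite ?IH // big1 // => j _; rewrite mulr0.
by case: (a == 1); rewrite IH mulr_sumr; apply: eq_bigr => j _; rewrite mulrCA.
Qed.

Lemma actM p r v i : act (p * r) v i = act p (act r v) i.
Proof.
rewrite [p * r]malgME act_sum [RHS]mmapE; apply: eq_bigr => m _.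
rewrite act_sum /= word_act_sum mulr_sumr; apply: eq_bigr => n _.
by rewrite actU fmM /word_act foldr_cat mulrA.
Qed.

Lemma act1 v i : act 1 v i = v i.
Proof. by rewrite actU mul1r fm1. Qed.

Lemma actZ c p v i : act (c *: p) v i = c * act p v i.
Proof. by rewrite -[c *: p]mul_malgC actM actU fm1. Qed.

Lemma actBM a b c d v i :
  act (a * b - c * d) v i = act a (act b v) i - act c (act d v) i.
Proof. by rewrite actB; congr (_ - _); apply: actM. Qed.

Lemma actBZM k a b c d v i :
  act (a * b - k *: (c * d)) v i = act a (act b v) i - k * act c (act d v) i.
Proof. by rewrite actB actZ; congr (_ - _ * _); apply: actM. Qed.

Lemma act_x v i : act free_x v i = if i is j.+1 then v j else 0.
Proof. by rewrite actU mul1r fmU. Qed.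

Lemma act_y v i : act free_y v i = yval i.+1 * v i.+1.
Proof. by rewrite actU mul1r fmU. Qed.

Lemma act_h v i : act free_h v i = hval i * v i.
Proof. by rewrite actU mul1r fmU. Qed.

Lemma act_poly (p : {poly F}) v i :
  act (free_poly p) v i = p.[hval i] * v i.
Proof.
rewrite /free_poly; elim/poly_ind: p v i => [|p c IH] v i; first by rewrite rmorph0 act0 horner0 mul0r.
rewrite rmorphD rmorphM /= horner_algX horner_algC actD actM IH act_h actZ act1.
by rewrite hornerMXaddC mulrDl mulrA.
Qed.

Lemma act_rels p v i : p \in qgha_rels -> act p v i = 0.
Proof.
rewrite !inE => /or3P[] /eqP->.
- rewrite actBM act_h act_x (act_x (act (free_poly f) _)).
  by case: i => [|i]; rewrite ?act_poly ?mulr0 subrr.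
- by rewrite actBM act_poly act_y (act_y v) act_h mulrCA subrr.
- rewrite actB actBZM act_poly (act_y (act free_x v)) (act_x v).
  rewrite (act_x (act free_y v)).
  case: i => [|i] /=; first by rewrite !mulr0 add0r subr0 subrr.
  by rewrite act_y /= mulrDl -[q * _ * _]mulrA addrAC addrK subrr.
Qed.

Lemma act_ideal p v i : in_ideal_gen qgha_rels p -> act p v i = 0.
Proof.
move=> Ip; elim: Ip v i => [|a s b c Ss _ IH] v i; first exact: act0.
rewrite actD IH addr0 -mulrA actM (@eq_act _ _ (act 0 v)).
  by rewrite -actM mulr0 act0.
by move=> j; rewrite actM act_rels // act0.
Qed.

Fact qgha_oner_neq0 : 1 != 0 :> qgha.
Proof.
apply/eqP; rewrite -[1 in LHS]quot_pi1 -(raddf0 (quot_pi qgha_rels)) => /quot_piP.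
move/(act_ideal (fun=> 1) 0)/eqP.
by rewrite subr0 act1 oner_eq0.
Qed.

HB.instance Definition _ := GRing.PzSemiRing_isNonZero.Build qgha qgha_oner_neq0.
HB.instance Definition _ :=
  GRing.Lmodule_isLalgebra.Build F qgha (@quot_scaleAl F _ qgha_rels).
HB.instance Definition _ :=
  GRing.Lalgebra_isAlgebra.Build F qgha (@quot_scaleAr F _ qgha_rels).

Definition qgha_x : qgha := quot_pi qgha_rels free_x.
Definition qgha_y : qgha := quot_pi qgha_rels free_y.
Definition qgha_h : qgha := quot_pi qgha_rels free_h.

Lemma quot_pi_poly (p : {poly F}) :
  quot_pi qgha_rels (free_poly p) = horner_alg qgha_h p.
Proof.
rewrite /free_poly; elim/poly_ind: p => [|p c IH]; first by rewrite !rmorph0 raddf0.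
rewrite !rmorphD !rmorphM /= !horner_algX !horner_algC raddfD /=.
by rewrite quot_piM IH quot_piZ.
Qed.

Lemma qgha_hx : qgha_h * qgha_x = qgha_x * horner_alg qgha_h f.
Proof.
rewrite -quot_pi_poly -!quot_piM.
exact/quot_piP/ideal_gen_mem/mem_head.
Qed.

Lemma qgha_yh : qgha_y * qgha_h = horner_alg qgha_h f * qgha_y.
Proof.
rewrite -quot_pi_poly -!quot_piM; apply/quot_piP/ideal_gen_mem.
by rewrite in_cons mem_head orbT.
Qed.

Lemma qgha_yx : qgha_y * qgha_x - q *: (qgha_x * qgha_y) = horner_alg qgha_h g.
Proof.
rewrite -quot_pi_poly -!quot_piM -quot_piZ -raddfB.
apply/quot_piP/ideal_gen_mem; rewrite 2!in_cons.
by apply/orP; right; apply/orP; right; apply: mem_head.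
Qed.

Section Universal.
Variables (B : algType F) (x y h : B).
Hypotheses (hx : h * x = x * horner_alg h f)
           (yh : y * h = horner_alg h f * y)
           (yx : y * x - q *: (x * y) = horner_alg h g).

Definition gen_eval (a : 'I_3) : B :=
  if a == 0 then x else if a == 1 then y else h.

Definition word_eval (m : {fmonom 'I_3}) : B := \prod_(a <- m) gen_eval a.

Fact word_eval_mmorphism : mmorphism word_eval.
Proof. by split=> [m n|]; rewrite /word_eval ?fm1 ?big_nil // fmM big_cat. Qed.

HB.instance Definition _ :=
  isMultiplicative.Build {fmonom 'I_3} B word_eval word_eval_mmorphism.

Definition free_eval (p : free_alg F) : B := mmap (in_alg B) word_eval p.

Fact free_evalB : {morph free_eval : p r / p - r}.
Proof. exact: (mmapB (f := in_alg B)). Qed.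

HB.instance Definition _ :=
  GRing.isZmodMorphism.Build (free_alg F) B free_eval free_evalB.

Fact free_evalM : monoid_morphism free_eval.
Proof.
have [M E] : multiplicative free_eval; last by split.
apply: (commr_mmap_is_multiplicative (f := in_alg B)) => p m n.
by rewrite /GRing.comm /= mulr_algl mulr_algr.
Qed.

HB.instance Definition _ :=
  GRing.isMonoidMorphism.Build (free_alg F) B free_eval free_evalM.

Lemma free_evalZ k p : free_eval (k *: p) = k *: free_eval p.
Proof. by rewrite /free_eval mmapZ /= mulr_algl. Qed.

Lemma free_eval_gen a : free_eval (free_gen F a) = gen_eval a.
Proof.
rewrite /free_eval (mmapU (f := in_alg B)) /= scale1r mul1r.
by rewrite /word_eval fmU big_seq1.
Qed.

Lemma free_eval_x : free_eval free_x = x.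
Proof. exact: free_eval_gen. Qed.

Lemma free_eval_y : free_eval free_y = y.
Proof. exact: free_eval_gen. Qed.

Lemma free_eval_h : free_eval free_h = h.
Proof. exact: free_eval_gen. Qed.

Lemma free_eval_poly (p : {poly F}) :
  free_eval (free_poly p) = horner_alg h p.
Proof.
rewrite /free_poly; elim/poly_ind: p => [|p c IH]; first by rewrite !rmorph0.
rewrite !rmorphD !rmorphM /= !horner_algX !horner_algC IH free_eval_h.
by rewrite free_evalZ rmorph1.
Qed.

Lemma free_eval_ideal p : in_ideal_gen qgha_rels p -> free_eval p = 0.
Proof.
elim=> [|a s b c Ss _ IH]; first exact: rmorph0.
rewrite rmorphD !rmorphM /= IH addr0; suff -> : free_eval s = 0.
  by rewrite mulr0 mul0r.
have EM k a1 b1 a2 b2 : free_eval (a1 * b1 - k *: (a2 * b2))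
    = free_eval a1 * free_eval b1 - k *: (free_eval a2 * free_eval b2).
  by rewrite rmorphB /= free_evalZ; congr (_ - _ *: _); apply: rmorphM.
move: Ss; rewrite !inE => /or3P[] /eqP->.
- rewrite -[X in _ - X]scale1r EM scale1r free_eval_poly.
  by rewrite free_eval_x free_eval_h hx subrr.
- rewrite -[X in _ - X]scale1r EM scale1r free_eval_poly.
  by rewrite free_eval_y free_eval_h yh subrr.
- rewrite rmorphB /= EM free_eval_poly.
  by rewrite free_eval_x free_eval_y yx subrr.
Qed.

Definition qgha_eval (u : qgha) : B := free_eval (repr u).

Lemma qgha_eval_pi p : qgha_eval (quot_pi qgha_rels p) = free_eval p.
Proof.
apply/eqP; rewrite -subr_eq0 -rmorphB; apply/eqP/free_eval_ideal.
by apply/quot_piP; rewrite quot_pi_repr.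
Qed.

Fact qgha_evalB : {morph qgha_eval : u v / u - v}.
Proof.
elim/quot_gen_ind=> a; elim/quot_gen_ind=> b.
by rewrite -raddfB !qgha_eval_pi rmorphB.
Qed.

Fact qgha_evalM : monoid_morphism qgha_eval.
Proof.
split; first by rewrite -quot_pi1 qgha_eval_pi rmorph1.
elim/quot_gen_ind=> a; elim/quot_gen_ind=> b.
by rewrite -quot_piM !qgha_eval_pi rmorphM.
Qed.

Fact qgha_evalZ : scalable qgha_eval.
Proof.
move=> k; elim/quot_gen_ind=> a.
by rewrite -quot_piZ !qgha_eval_pi free_evalZ.
Qed.

HB.instance Definition _ :=
  GRing.isZmodMorphism.Build qgha B qgha_eval qgha_evalB.
HB.instance Definition _ :=
  GRing.isMonoidMorphism.Build qgha B qgha_eval qgha_evalM.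
HB.instance Definition _ := GRing.isScalable.Build F qgha B *:%R qgha_eval qgha_evalZ.

Lemma qgha_eval_x : qgha_eval qgha_x = x.
Proof. by rewrite qgha_eval_pi free_eval_x. Qed.

Lemma qgha_eval_y : qgha_eval qgha_y = y.
Proof. by rewrite qgha_eval_pi free_eval_y. Qed.

Lemma qgha_eval_h : qgha_eval qgha_h = h.
Proof. by rewrite qgha_eval_pi free_eval_h. Qed.

Lemma qgha_eval_unique (phi : {lrmorphism qgha -> B}) :
  phi qgha_x = x -> phi qgha_y = y -> phi qgha_h = h -> phi =1 qgha_eval.
Proof.
move=> phix phiy phih; elim/quot_gen_ind=> p; rewrite qgha_eval_pi.
have phi_gen a : phi (quot_pi qgha_rels (free_gen F a)) = gen_eval a.
  rewrite /gen_eval; case: (a =P 0) => [->//|/eqP a0].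
  case: (a =P 1) => [->//|/eqP a1]; rewrite -phih; congr (phi (quot_pi _ _)).
  by rewrite /free_h; congr free_gen; apply/val_inj; case: a a0 a1 => [[|[|[]]]].
have phi_word (s : seq 'I_3) :
    phi (quot_pi qgha_rels << fmonom_of_seq fmonom_key s >>)
    = \prod_(a <- s) gen_eval a.
  elim: s => [|a s IH]; first by rewrite big_nil -(rmorph1 phi) -quot_pi1.
  rewrite big_cons -IH -phi_gen -rmorphM -quot_piM; congr (phi (quot_pi _ _)).
  rewrite [RHS]fgmulUU mulr1; congr << _ >>.
  by rewrite /mul /= fmmulE fmuE !fmE.
rewrite [in LHS](monalgE p) /free_eval mmapE !raddf_sum; apply: eq_bigr => m _.
have -> : << p@_m *g m >> = p@_m *: (<< m >> : free_alg F).
  by rewrite -[RHS]mul_malgC [RHS]fgmulUU mulr1 mul1m.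
rewrite /= quot_piZ linearZ /= mulr_algl; congr (_ *: _).
by rewrite -[m in LHS]fmK -fmE phi_word.
Qed.

Lemma qgha_lift :
  exists phi : {lrmorphism qgha -> B},
    [/\ phi qgha_x = x, phi qgha_y = y & phi qgha_h = h].
Proof.
exists (qgha_eval : {lrmorphism qgha -> B}).
by split; [exact: qgha_eval_x | exact: qgha_eval_y | exact: qgha_eval_h].
Qed.

End Universal.

End QGHA.

(* Main.v *)
From HB Require Import structures.
Require Import Defs.
From mathcomp Require Import all_boot all_order all_algebra.

Set Implicit Arguments.
Unset Strict Implicit.
Unset Printing Implicit Defensive.

Import GRing.Theory.
Local Open Scope ring_scope.

(**
Write H for the algebra H_q(f,g).  Ordering monomials as x^i p(h) y^k exhibits
H as an iterated Ore extension, up to reversing products: let R = F[h][y; s]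
with s(p) = p o f, so that y p = s(p) y; then the relations say that moving x
to the left past r in R costs
    r x = x t(r) + d(r),
where t is the endomorphism h |-> f(h), y |-> q y of R and d is the
t-derivation with d(h) = 0 and d(y) = g(h).  In the opposite ring this reads
x r = t(r) x + d(r), that is, H^op = R^op[x; t, d].

An Ore extension D[x; s, d] is constructed here on the additive group of
polynomials over D (ore): left multiplication by x is the operator ore_shift,
and a product u v is the value of u at that operator, applied to v.
Associativity is then the fact that the operator of left multiplication by x
commutes with right multiplications.  Applying the construction twice gives a
ring, whose opposite is the algebra model.  Both H and model have generators
subject to the defining relations, hence map to each other (qgha_lift,
model_lift), and the composite H -> model -> H is the identity by uniqueness:
H embeds in model (qgha_embeds_model).  This is the independence of the
ordered monomials, in a form that needs no monomials.

If q is nonzero and f is not constant, then s and t are injective.  The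
leading coefficient of a product in D[x; s, d] is a s^m(b) with a, b the
leading coefficients of the factors and m the degree of the first one, so
D[x; s, d] has no zero divisors when D has none and s is injective
(ore_no_zero_divisors).  Two applications, starting from F[h], show that model
and hence H are domains.

Conversely y, which is nonzero in model, is a left zero divisor in the
excluded cases.  If f = c is constant, then y (h - c) = (c - c) y = 0.  If
q = 0, then y x = g(h).  For g = 0 this exhibits the zero divisor.  For g
nonzero, the powers of f are linearly dependent modulo g, so some nonzero p has
p o f = r g (dvdp_comp_poly), and
    y (x r(h) y - p(h)) = g(h) r(h) y - (p o f)(h) y = 0,
where the second factor is nonzero because no nonzero p(h) lies in x H.
*)

(** * Ore extensions *)

Definition skew_derivation (D : nzRingType) (s d : D -> D) : Prop :=
  forall a b, d (a * b) = s a * d b + d a * b.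

(** The Ore extension D[x; s, d], with x a = s(a) x + d(a).  The derivation law
is an index of the type so that the ring structure can be recovered from it. *)
Definition ore (D : nzRingType) (s : {rmorphism D -> D})
  (d : {additive D -> D}) (dM : skew_derivation s d) : Type := {poly D}.

Section Ore.
Variables (D : nzRingType) (s : {rmorphism D -> D}) (d : {additive D -> D}).
Hypothesis dM : skew_derivation s d.

(** Left multiplication by x in D[x; s, d]. *)
Definition ore_shift (v : {poly D}) : {poly D} := map_poly s v * 'X + map_poly d v.

Fact ore_shift_is_zmod_morphism : {morph ore_shift : u v / u - v}.
Proof.
by move=> u v; rewrite /ore_shift !raddfB mulrBl opprD addrACA.
Qed.

HB.instance Definition _ :=
  GRing.isZmodMorphism.Build {poly D} {poly D} ore_shift ore_shift_is_zmod_morphism.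

Fact ore_iter_is_zmod_morphism i : {morph iter i ore_shift : u v / u - v}.
Proof. by elim: i => [|i IH] u v; rewrite ?iterS ?IH ?raddfB. Qed.

HB.instance Definition _ i :=
  GRing.isZmodMorphism.Build {poly D} {poly D} (iter i ore_shift)
    (ore_iter_is_zmod_morphism i).

Lemma coef_ore_shift v i :
  (ore_shift v)`_i = (if i is j.+1 then s v`_j else 0) + d v`_i.
Proof. by rewrite coefD coefMX !coef_map; case: i. Qed.

Lemma ore_shiftZ a v : ore_shift (a *: v) = s a *: ore_shift v + d a *: v.
Proof.
apply/polyP=> i; rewrite coef_ore_shift coefD !coefZ coef_ore_shift dM mulrDr addrA.
by case: i => [|i]; rewrite ?coefZ ?mulr0 // rmorphM.
Qed.

Definition ore_mul (u v : {poly D}) : {poly D} :=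
  \sum_(i < size u) u`_i *: iter i ore_shift v.

(** Padding with zero coefficients puts products of elements of different
degrees over a common index range. *)
Lemma ore_mul_wide n (u v : {poly D}) : (size u <= n)%N ->
  ore_mul u v = \sum_(i < n) u`_i *: iter i ore_shift v.
Proof.
move=> un; rewrite /ore_mul (big_ord_widen _ (fun i => u`_i *: iter i ore_shift v) un).
rewrite big_mkcond; apply: eq_bigr => i _; case: ltnP => // ?.
by rewrite nth_default // scale0r.
Qed.

Lemma ore_mulDl : left_distributive ore_mul +%R.
Proof.
move=> u v w; pose n := maxn (size u) (size v).
rewrite !(@ore_mul_wide n) ?leq_maxl ?leq_maxr ?size_polyD // -big_split.
by apply: eq_bigr => i _; rewrite coefD scalerDl.
Qed.

Lemma ore_mulDr : right_distributive ore_mul +%R.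
Proof.
move=> u v w; rewrite /ore_mul -big_split.
by apply: eq_bigr => i _; rewrite raddfD scalerDr.
Qed.

Lemma ore_mulCl a v : ore_mul a%:P v = a *: v.
Proof.
by rewrite (@ore_mul_wide 1) ?size_polyC_leq1 // big_ord1 coefC.
Qed.

Lemma ore_mulZl a u v : ore_mul (a *: u) v = a *: ore_mul u v.
Proof.
rewrite (@ore_mul_wide (size u)) ?size_scale_leq // scaler_sumr.
by apply: eq_bigr => i _; rewrite coefZ scalerA.
Qed.

Lemma ore_mulXl v : ore_mul 'X v = ore_shift v.
Proof.
by rewrite (@ore_mul_wide 2) ?size_polyX // !big_ord_recl big_ord0 !coefX /=
  scale0r add0r addr0 scale1r.
Qed.

Lemma ore_mul0l v : ore_mul 0 v = 0.
Proof. by rewrite -polyC0 ore_mulCl scale0r. Qed.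

Lemma ore_mul_suml (I : Type) (r : seq I) (P : pred I) (U : I -> {poly D}) v :
  ore_mul (\sum_(i <- r | P i) U i) v = \sum_(i <- r | P i) ore_mul (U i) v.
Proof.
apply: (big_morph (ore_mul^~ v)) => [u w|]; first exact: ore_mulDl.
exact: ore_mul0l.
Qed.

(** A skew derivation vanishes at 1, so the powers of x are the ordinary
monomials. *)
Lemma iter_ore_shift1 i : iter i ore_shift 1 = 'X^i.
Proof.
elim: i => [//|i IH]; rewrite iterS IH; apply/polyP=> j.
have d1 : d 1 = 0.
  by apply/(addrI (d 1)); rewrite addr0 -{3}[1]mulr1 dM rmorph1 mul1r mulr1.
rewrite coef_ore_shift !coefXn raddfMn d1 mul0rn addr0.
by case: j => [//|j]; rewrite coefXn rmorph_nat.
Qed.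

Lemma ore_mulr1 : right_id 1 ore_mul.
Proof.
move=> u; rewrite -[RHS]coefK poly_def; apply: eq_bigr => i _.
by rewrite iter_ore_shift1.
Qed.

(** This is the associativity law (x v) w = x (v w), to which the general one
reduces because products are left linear combinations of iterates of the
shift. *)
Lemma ore_shiftMl v w : ore_mul (ore_shift v) w = ore_shift (ore_mul v w).
Proof.
rewrite [ore_mul v w]/ore_mul raddf_sum /=.
under [RHS]eq_bigr do rewrite ore_shiftZ -iterS.
rewrite (@ore_mul_wide (size v).+1); last first.
  apply/leq_sizeP=> [[//|j]] vj.
  by rewrite coef_ore_shift !nth_default ?raddf0 ?addr0 // ltnW.
under [LHS]eq_bigr do rewrite coef_ore_shift scalerDl.
rewrite big_split /= big_ord_recl /= scale0r add0r [X in _ + X]big_ord_recr /=.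
by rewrite [v`_(size v)]nth_default // raddf0 scale0r addr0 big_split.
Qed.

Lemma ore_mulA : associative ore_mul.
Proof.
move=> u v w; rewrite {2}/ore_mul ore_mul_suml; apply: eq_bigr => i _.
rewrite ore_mulZl; congr (_ *: _); elim: (val i) => //= j IH.
by rewrite ore_shiftMl IH.
Qed.

Lemma ore_mul1r : left_id 1 ore_mul.
Proof. by move=> u; rewrite ore_mulCl scale1r. Qed.

HB.instance Definition _ := GRing.Zmodule.copy (ore dM) {poly D}.
HB.instance Definition _ := GRing.Zmodule_isNzRing.Build (ore dM)
  ore_mulA ore_mul1r ore_mulr1 ore_mulDl ore_mulDr (oner_neq0 {poly D}).

Definition oreC (a : D) : ore dM := a%:P.
Definition oreX : ore dM := 'X.

Lemma oreM (u v : ore dM) : u * v = ore_mul u v. Proof. by []. Qed.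

Lemma oreC_inj : injective oreC.
Proof. exact: polyC_inj. Qed.

Fact oreC_is_zmod_morphism : {morph oreC : a b / a - b}.
Proof. exact: polyCB. Qed.

Fact oreC_is_monoid_morphism : monoid_morphism oreC.
Proof.
by split=> // a b; rewrite oreM ore_mulCl /oreC polyCM mul_polyC.
Qed.

Lemma oreCM a b : oreC (a * b) = oreC a * oreC b.
Proof. by rewrite oreC_is_monoid_morphism.2. Qed.

HB.instance Definition _ :=
  GRing.isZmodMorphism.Build D (ore dM) oreC oreC_is_zmod_morphism.
HB.instance Definition _ :=
  GRing.isMonoidMorphism.Build D (ore dM) oreC oreC_is_monoid_morphism.

Lemma oreX_C a : oreX * oreC a = oreC (s a) * oreX + oreC (d a).
Proof.
by rewrite !oreM ore_mulXl ore_mulCl /ore_shift !map_polyC mul_polyC.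
Qed.

Lemma ore_mulrX (u : ore dM) : u * oreX = (u : {poly D}) * 'X :> {poly D}.
Proof.
rewrite oreM -[in RHS](coefK (u : {poly D})) poly_def mulr_suml.
apply: eq_bigr => i _.
rewrite -scalerAl -exprSr -iter_ore_shift1 iterSr; congr (_ *: iter _ _ _).
exact/esym/(iter_ore_shift1 1).
Qed.

(** Central constants that s fixes and d kills stay central; this is how the
scalars of F are carried up the tower. *)
Lemma oreC_central c : (forall a, a * c = c * a) -> s c = c -> d c = 0 ->
  forall u, u * oreC c = oreC c * u.
Proof.
move=> cC sc dc u; rewrite !oreM ore_mulCl /oreC -alg_polyC.
have cZ i : iter i ore_shift c%:A = c *: 'X^i.
  elim: i => [//|i IH]; rewrite iterS IH ore_shiftZ sc dc scale0r addr0.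
  by rewrite -iter_ore_shift1 -iterS iter_ore_shift1.
rewrite -{2}[u]coefK poly_def scaler_sumr; apply: eq_bigr => i _.
by rewrite cZ !scalerA cC.
Qed.

(** The universal property: a morphism r from D and an element z satisfying the
commutation rule of x determine a ring morphism from the Ore extension. *)
Section Eval.
Variables (S : nzRingType) (r : {rmorphism D -> S}) (z : S).
Hypothesis zr : forall a, z * r a = r (s a) * z + r (d a).

Definition ore_eval (u : ore dM) : S := (map_poly r u).[z].

Lemma ore_eval_wide n (u : ore dM) : (size (u : {poly D}) <= n)%N ->
  ore_eval u = \sum_(i < n) r (u : {poly D})`_i * z ^+ i.
Proof.
move=> un; rewrite /ore_eval (@horner_coef_wide _ n).
  by apply: eq_bigr => i _; rewrite coef_map.
exact: leq_trans (size_poly _ _) un.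
Qed.

Fact ore_eval_is_zmod_morphism : {morph ore_eval : u v / u - v}.
Proof. by move=> u v; rewrite /ore_eval raddfB hornerD hornerN. Qed.

HB.instance Definition _ :=
  GRing.isZmodMorphism.Build (ore dM) S ore_eval ore_eval_is_zmod_morphism.

Lemma ore_evalC a : ore_eval (oreC a) = r a.
Proof. by rewrite /ore_eval map_polyC hornerC. Qed.

Lemma ore_evalX : ore_eval oreX = z.
Proof. by rewrite /ore_eval map_polyX hornerX. Qed.

Lemma ore_evalZ a (u : {poly D}) : ore_eval (a *: u) = r a * ore_eval u.
Proof.
rewrite [ore_eval u](ore_eval_wide (leqnn _)).
rewrite (@ore_eval_wide (size u)) ?size_scale_leq // mulr_sumr.
by apply: eq_bigr => i _; rewrite coefZ rmorphM mulrA.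
Qed.

Lemma ore_eval_shift (u : {poly D}) : ore_eval (ore_shift u) = z * ore_eval u.
Proof.
have mapE (t : {additive D -> D}) :
    (map_poly r (map_poly t u)).[z] = \sum_(i < size u) r (t u`_i) * z ^+ i.
  rewrite (@horner_coef_wide _ (size u)).
    by apply: eq_bigr => i _; rewrite !coef_map.
  exact: leq_trans (size_poly _ _) (size_poly _ _).
rewrite {1}/ore_eval /ore_shift rmorphD rmorphM /= map_polyX hornerD hornerMX !mapE.
rewrite (ore_eval_wide (leqnn _)) mulr_suml mulr_sumr -big_split.
apply: eq_bigr => i _ /=.
by rewrite -mulrA -exprSr exprS !mulrA zr mulrDl.
Qed.

Fact ore_eval_is_monoid_morphism : monoid_morphism ore_eval.
Proof.
split=> [|u v]; first by rewrite -(rmorph1 oreC) ore_evalC rmorph1.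
rewrite oreM /ore_mul raddf_sum (ore_eval_wide (leqnn _)) mulr_suml.
apply: eq_bigr => i _ /=; rewrite ore_evalZ -mulrA; congr (_ * _).
elim: (val i) => [|j IH]; first by rewrite mul1r.
by rewrite iterS ore_eval_shift IH exprS mulrA.
Qed.

HB.instance Definition _ :=
  GRing.isMonoidMorphism.Build (ore dM) S ore_eval ore_eval_is_monoid_morphism.

End Eval.

(** Only the leading terms a x^m and b x^n contribute in top degree, and each of
the m crossings of x over b applies s once. *)
Lemma coef_ore_mul_lead (u v : {poly D}) : u != 0 -> v != 0 ->
  (ore_mul u v)`_((size u).-1 + (size v).-1)
  = lead_coef u * iter (size u).-1 s (lead_coef v).
Proof.
move=> u0 v0; pose n := (size v).-1.
have iterP i : (size (iter i ore_shift v) <= (i + n).+1)%N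
    /\ (iter i ore_shift v)`_(i + n) = iter i s (lead_coef v).
  elim: i => [|i [sz lc]]; first by rewrite /n prednK ?size_poly_gt0.
  rewrite !iterS; split.
    apply/leq_sizeP=> [[//|j]]; rewrite addSn ltnS => /(leq_trans sz) szj.
    by rewrite coef_ore_shift !nth_default ?raddf0 ?addr0 // ltnW.
  rewrite addSn coef_ore_shift lc [_`_(i + n).+1]nth_default ?raddf0 ?addr0 //.
rewrite /ore_mul -(prednK (_ : 0 < size u)%N) ?size_poly_gt0 // big_ord_recr /=.
rewrite coefD coefZ (iterP _).2 coef_sum big1 ?add0r // => i _.
rewrite coefZ [_`_(_ + _)]nth_default ?mulr0 //.
by apply: leq_trans (iterP i).1 _; rewrite ltn_add2r.
Qed.

End Ore.

Definition no_zero_divisors (A : nzRingType) : Prop :=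
  forall a b : A, a != 0 -> b != 0 -> a * b != 0.

Lemma ore_no_zero_divisors (D : nzRingType) (s : {rmorphism D -> D})
    (d : {additive D -> D}) (dM : skew_derivation s d) :
  injective s -> no_zero_divisors D -> no_zero_divisors (ore dM).
Proof.
move=> s_inj D_dom u v u0 v0; pose n := ((size (u : {poly D})).-1
  + (size (v : {poly D})).-1)%N.
apply/eqP=> /(congr1 (fun w : {poly D} => w`_n)).
rewrite oreM coef_ore_mul_lead // coef0; apply/eqP/D_dom.
  by rewrite lead_coef_eq0.
elim: (_.-1) => [|i IH]; first by rewrite lead_coef_eq0.
by rewrite iterS -(raddf0 s) (inj_eq s_inj).
Qed.

(** * The model: an iterated Ore extension *)

(** A ring becomes an F-algebra through a morphism from F with central image;
the type remembers this morphism so that the scaling can be inferred. *)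
Definition central_alg (F : fieldType) (A : nzRingType) (i : {rmorphism F -> A})
  (iC : forall k a, i k * a = a * i k) : Type := A.

Section CentralAlgebra.
Variables (F : fieldType) (A : nzRingType) (i : {rmorphism F -> A}).
Hypothesis iC : forall k a, i k * a = a * i k.

HB.instance Definition _ := GRing.NzRing.copy (central_alg iC) A.

Definition central_scale (k : F) (u : central_alg iC) : central_alg iC := i k * u.

Fact central_scaleA a b u :
  central_scale a (central_scale b u) = central_scale (a * b) u.
Proof. by rewrite /central_scale rmorphM mulrA. Qed.

Fact central_scale1 : left_id 1 central_scale.
Proof. by move=> u; rewrite /central_scale rmorph1 mul1r. Qed.

Fact central_scaleDr : right_distributive central_scale +%R.
Proof. by move=> k u v; apply: mulrDr. Qed.

Fact central_scaleDl u : {morph central_scale^~ u : a b / a + b}.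
Proof. by move=> a b; rewrite /central_scale rmorphD mulrDl. Qed.

HB.instance Definition _ := GRing.Zmodule_isLmodule.Build F (central_alg iC)
  central_scaleA central_scale1 central_scaleDr central_scaleDl.

Fact central_scaleAl k (u v : central_alg iC) : k *: (u * v) = (k *: u) * v.
Proof. exact: mulrA. Qed.

HB.instance Definition _ :=
  GRing.Lmodule_isLalgebra.Build F (central_alg iC) central_scaleAl.

Fact central_scaleAr k (u v : central_alg iC) : k *: (u * v) = u * (k *: v).
Proof.
by rewrite /GRing.scale /= /central_scale [LHS]mulrA iC -[LHS]mulrA.
Qed.

HB.instance Definition _ :=
  GRing.Lalgebra_isAlgebra.Build F (central_alg iC) central_scaleAr.

Lemma central_scaleE k (u : central_alg iC) : k *: u = i k * (u : A).
Proof. by []. Qed.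

End CentralAlgebra.

Lemma skew_derivation0 (D : nzRingType) (s : {rmorphism D -> D}) :
  skew_derivation s (\0 : {additive D -> D})%R.
Proof. by move=> a b; rewrite /= mulr0 mul0r addr0. Qed.

(** Throughout, R = F[h][y; s] is skew_hy; comp_hom, twist and twist_der are the
maps s, t and d that govern the commutation of y and of x. *)
Section Model.
Variables (F : fieldType) (q : F) (f g : {poly F}).

Definition comp_hom : {rmorphism {poly F} -> {poly F}} := comp_poly f.

Definition skew_hy : Type := ore (skew_derivation0 comp_hom).
HB.instance Definition _ := GRing.NzRing.on skew_hy.

Lemma shift_hy (u : {poly {poly F}}) i :
  (ore_shift comp_hom \0 u)`_i = if i is j.+1 then u`_j \Po f else 0.
Proof. by rewrite coef_ore_shift /= addr0. Qed.

(** The endomorphism of R determined by h |-> f(h) and y |-> q y. *)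
Definition twist (u : skew_hy) : skew_hy :=
  \poly_(i < size (u : {poly {poly F}})) (q ^+ i *: ((u : {poly {poly F}})`_i \Po f)).

(** The coefficient s_k in y^k x = q^k x y^k + s_k(h) y^(k-1); the recursion
comes from multiplying this relation by y on the left, see yX_x. *)
Fixpoint commut_coef (k : nat) : {poly F} :=
  if k is j.+1 then q ^+ j *: g + (commut_coef j \Po f) else 0.

Lemma commut_coefS k : commut_coef k.+1 = q ^+ k *: g + (commut_coef k \Po f).
Proof. by []. Qed.

(** The value d(p y^k) = p s_k y^(k-1), extended additively. *)
Definition twist_der (u : skew_hy) : skew_hy :=
  \poly_(i < size (u : {poly {poly F}}))
    ((u : {poly {poly F}})`_i.+1 * commut_coef i.+1).

Lemma coef_twist (u : skew_hy) i :
  (twist u : {poly {poly F}})`_i = q ^+ i *: ((u : {poly {poly F}})`_i \Po f).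
Proof.
rewrite coef_poly; case: ltnP => // ui.
by rewrite nth_default // comp_poly0 scaler0.
Qed.

Lemma coef_twist_der (u : skew_hy) i :
  (twist_der u : {poly {poly F}})`_i = (u : {poly {poly F}})`_i.+1 * commut_coef i.+1.
Proof.
rewrite coef_poly; case: ltnP => // ui.
by rewrite nth_default ?mul0r // leqW.
Qed.

Fact twist_is_zmod_morphism : {morph twist : u v / u - v}.
Proof.
move=> u v; apply/polyP=> i.
by rewrite coefB !coef_twist coefB raddfB scalerBr.
Qed.

HB.instance Definition _ :=
  GRing.isZmodMorphism.Build skew_hy skew_hy twist twist_is_zmod_morphism.

Fact twist_der_is_zmod_morphism : {morph twist_der : u v / u - v}.
Proof.
move=> u v; apply/polyP=> i.
by rewrite coefB !coef_twist_der coefB mulrBl.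
Qed.

HB.instance Definition _ :=
  GRing.isZmodMorphism.Build skew_hy skew_hy twist_der twist_der_is_zmod_morphism.

Lemma twistZ (p : {poly F}) (u : {poly {poly F}}) :
  twist (p *: u) = (p \Po f) *: (twist u : {poly {poly F}}).
Proof.
by apply/polyP=> i; rewrite coefZ !coef_twist coefZ rmorphM /= scalerAr.
Qed.

Lemma twist_derZ (p : {poly F}) (u : {poly {poly F}}) :
  twist_der (p *: u) = p *: (twist_der u : {poly {poly F}}).
Proof.
by apply/polyP=> i; rewrite coefZ !coef_twist_der coefZ mulrA.
Qed.

Local Notation Y := (ore_shift comp_hom \0).

(** Multiplicativity of twist when the left factor is y; coefficients being
handled by twistZ, general products follow by iteration.  The pair
twist_derZ, twist_der_shift plays the same role for twist_der. *)
Lemma twist_shift u : twist (Y u) = q%:P *: Y (twist u).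
Proof.
apply/polyP=> i; rewrite coef_twist coefZ !shift_hy mul_polyC.
case: i => [|i]; first by rewrite comp_poly0 !scaler0.
by rewrite coef_twist linearZ /= scalerA exprS.
Qed.

Lemma twist_der_shift u :
  twist_der (Y u) = g *: (twist u : {poly {poly F}}) + Y (twist_der u).
Proof.
apply/polyP=> i; rewrite coefD coefZ coef_twist coef_twist_der !shift_hy.
rewrite mulrDr -scalerAr scalerAl mulrC; congr (_ + _).
by case: i => [|i]; rewrite ?comp_poly0 ?mulr0 // coef_twist_der comp_polyM.
Qed.

Lemma twist_iter i u : twist (iter i Y u) = (q ^+ i)%:P *: iter i Y (twist u).
Proof.
elim: i => [|i IH]; first by rewrite scale1r.
rewrite !iterS twist_shift IH ore_shiftZ ?scale0r ?addr0; last exact: skew_derivation0.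
by rewrite /= comp_polyC scalerA -polyCM -exprS.
Qed.

Fact twist_is_monoid_morphism : monoid_morphism twist.
Proof.
split=> [|u v].
  apply/polyP=> i; rewrite coef_twist !coefC; case: i => [|i].
    by rewrite expr0 scale1r comp_polyC.
  by rewrite comp_poly0 scaler0.
rewrite !oreM (@ore_mul_wide _ _ _ (size (u : {poly {poly F}})) (twist u)) ?size_poly //.
rewrite [in LHS]/ore_mul raddf_sum; apply: eq_bigr => i _ /=.
by rewrite twistZ twist_iter scalerA coef_twist mulrC mul_polyC.
Qed.

HB.instance Definition _ :=
  GRing.isMonoidMorphism.Build skew_hy skew_hy twist twist_is_monoid_morphism.

Lemma twist_der_iter i u : twist_der (iter i Y u)
  = commut_coef i *: iter i.-1 Y (twist u) + iter i Y (twist_der u).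
Proof.
elim: i => [|i IH]; first by rewrite scale0r add0r.
rewrite !iterS twist_der_shift IH raddfD /= addrA; congr (_ + _).
rewrite twist_iter scalerA ore_shiftZ ?scale0r ?addr0 /=; last exact: skew_derivation0.
rewrite scalerDl mulrC mul_polyC; congr (_ + _).
by case: i {IH} => [|i] //=; rewrite comp_poly0 !scale0r.
Qed.

(** The product law holds here with the two factors in the order opposite to
that of skew_derivation: twist_der is a skew derivation of the converse ring. *)
Lemma twist_derM (u v : skew_hy) :
  twist_der (u * v) = twist_der u * twist v + u * twist_der v.
Proof.
pose n := (size (u : {poly {poly F}})).+1.
rewrite !oreM (@ore_mul_wide _ _ _ n u v) ?leqnSn //.
rewrite (@ore_mul_wide _ _ _ n u) ?leqnSn // raddf_sum.
rewrite (@ore_mul_wide _ _ _ n.-1 (twist_der u)) ?size_poly //.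
under eq_bigr do rewrite /= twist_derZ twist_der_iter scalerDr scalerA.
rewrite big_split; congr (_ + _).
(* The index shift: commut_coef 0 = 0 removes the term without a predecessor. *)
rewrite big_ord_recl /= mulr0 scale0r add0r.
by apply: eq_bigr => i _; rewrite coef_twist_der.
Qed.

Lemma skew_hy_opM (u v : skew_hy) : (u : skew_hy^c) * (v : skew_hy^c) = v * u.
Proof. by []. Qed.

Definition twist_op : skew_hy^c -> skew_hy^c := twist.
Definition twist_der_op : skew_hy^c -> skew_hy^c := twist_der.

HB.instance Definition _ :=
  GRing.isZmodMorphism.Build skew_hy^c skew_hy^c twist_op twist_is_zmod_morphism.
HB.instance Definition _ := GRing.isZmodMorphism.Build skew_hy^c skew_hy^c
  twist_der_op twist_der_is_zmod_morphism.

Fact twist_op_is_monoid_morphism : monoid_morphism twist_op.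
Proof.
split; first exact: (rmorph1 twist).
by move=> u v; apply: (rmorphM twist).
Qed.

HB.instance Definition _ := GRing.isMonoidMorphism.Build skew_hy^c skew_hy^c
  twist_op twist_op_is_monoid_morphism.

Definition twist_hom : {rmorphism skew_hy^c -> skew_hy^c} := twist_op.
Definition twist_der_add : {additive skew_hy^c -> skew_hy^c} := twist_der_op.

Fact twist_op_derivation : skew_derivation twist_hom twist_der_add.
Proof. by move=> u v; apply: twist_derM. Qed.

(** The second extension has its coefficients in the converse of skew_hy, since
x commutes past R from the right in H but from the left in an Ore extension;
taking the converse again restores the order of products. *)
Definition model_ore : Type := ore twist_op_derivation.
HB.instance Definition _ := GRing.NzRing.on model_ore.

Definition model_ring : Type := model_ore^c.
HB.instance Definition _ := GRing.NzRing.on model_ring.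

Lemma model_ringM (u v : model_ring) : u * v = (v : model_ore) * (u : model_ore).
Proof. by []. Qed.

Definition model_poly (p : {poly F}) : model_ring :=
  oreC twist_op_derivation (oreC (skew_derivation0 comp_hom) p).

Fact model_poly_is_zmod_morphism : {morph model_poly : u v / u - v}.
Proof. by move=> u v; rewrite /model_poly !raddfB. Qed.

Fact model_poly_is_monoid_morphism : monoid_morphism model_poly.
Proof.
split=> [|u v]; first by rewrite /model_poly !rmorph1.
by rewrite model_ringM /model_poly -oreCM skew_hy_opM rmorphM.
Qed.

HB.instance Definition _ := GRing.isZmodMorphism.Build {poly F} model_ring
  model_poly model_poly_is_zmod_morphism.
HB.instance Definition _ := GRing.isMonoidMorphism.Build {poly F} model_ring
  model_poly model_poly_is_monoid_morphism.

Lemma twistC (p : {poly F}) :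
  twist (oreC (skew_derivation0 comp_hom) p)
  = oreC (skew_derivation0 comp_hom) (p \Po f).
Proof.
apply/polyP=> i; rewrite coef_twist !coefC.
by case: i => [|i]; rewrite ?expr0 ?scale1r ?comp_poly0 ?scaler0.
Qed.

Lemma twist_derC (p : {poly F}) :
  twist_der (oreC (skew_derivation0 comp_hom) p) = 0.
Proof. by apply/polyP=> i; rewrite coef_twist_der coefC mul0r; apply/esym/coef0. Qed.

Fact model_scalarC k a :
  model_poly k%:P * a = a * model_poly k%:P.
Proof.
apply: (oreC_central (dM := twist_op_derivation)) => [b||].
- rewrite !skew_hy_opM; apply/esym/oreC_central => //= [p|].
    exact: mulrC.
  exact: comp_polyC.
- by rewrite /= /twist_op twistC comp_polyC.
- exact: twist_derC.
Qed.

Definition model : Type :=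
  central_alg (i := model_poly \o polyC) model_scalarC.
HB.instance Definition _ := GRing.Algebra.on model.

Definition model_x : model := oreX twist_op_derivation.
Definition model_y : model :=
  oreC twist_op_derivation (oreX (skew_derivation0 comp_hom)).
Definition model_h : model := model_poly 'X.

Lemma horner_model_h p : horner_alg model_h p = model_poly p.
Proof.
elim/poly_ind: p => [|p c IH]; first by rewrite !rmorph0.
rewrite !rmorphD !rmorphM /= horner_algX horner_algC IH; congr (_ + _).
by rewrite central_scaleE mulr1.
Qed.
End Model.

(** * The universal property of the model *)
Section Converse.
Variables (A B : nzRingType) (r : {rmorphism A -> B}).

Definition conv_morph : A^c -> B^c := r.

Fact conv_morph_is_zmod_morphism : {morph conv_morph : a b / a - b}.
Proof. exact: (raddfB r). Qed.

Fact conv_morph_is_monoid_morphism : monoid_morphism conv_morph.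
Proof. by split=> [|a b]; [apply: (rmorph1 r) | apply: (rmorphM r)]. Qed.

HB.instance Definition _ := GRing.isZmodMorphism.Build A^c B^c conv_morph
  conv_morph_is_zmod_morphism.
HB.instance Definition _ := GRing.isMonoidMorphism.Build A^c B^c conv_morph
  conv_morph_is_monoid_morphism.

End Converse.

Section ModelRelations.
Variables (F : fieldType) (q : F) (f g : {poly F}).

Let X := model_x q f g.
Let Y := model_y q f g.
Let H := model_h q f g.

Lemma modelM (u v : model q f g) :
  u * v = (v : model_ore q f g) * (u : model_ore q f g).
Proof. by []. Qed.

Lemma model_hx : H * X = X * horner_alg H f.
Proof.
rewrite horner_model_h !modelM oreX_C /= /twist_op /twist_der_op.
by rewrite twistC twist_derC comp_polyX rmorph0 addr0.
Qed.

Lemma model_yh : Y * H = horner_alg H f * Y.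
Proof.
rewrite horner_model_h !modelM -[LHS]rmorphM -[RHS]rmorphM; congr oreC.
by rewrite !skew_hy_opM oreX_C /= comp_polyX rmorph0 addr0.
Qed.

Lemma twist_y : twist q (oreX (skew_derivation0 (comp_hom f)))
  = oreC (skew_derivation0 (comp_hom f)) q%:P * oreX (skew_derivation0 (comp_hom f)).
Proof.
rewrite oreM ore_mulCl; apply/polyP=> i; rewrite coef_twist coefZ !coefX.
case: i => [|[|i]]; rewrite ?expr1 ?comp_poly0 ?scaler0 ?mulr0 //=.
by rewrite comp_polyC mulr1 alg_polyC.
Qed.

Lemma twist_der_y : twist_der q g (oreX (skew_derivation0 (comp_hom f)))
  = oreC (skew_derivation0 (comp_hom f)) g.
Proof.
apply/polyP=> i; rewrite coef_twist_der coefX coefC.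
by case: i => [|i]; rewrite ?mul0r //= comp_poly0 expr0 scale1r addr0 mul1r.
Qed.

Lemma model_yx : Y * X - q *: (X * Y) = horner_alg H g.
Proof.
rewrite horner_model_h; apply/eqP; rewrite subr_eq addrC; apply/eqP.
rewrite central_scaleE !modelM oreX_C /= /twist_op /twist_der_op.
rewrite twist_y twist_der_y; congr (_ + _).
rewrite -[RHS]/((Y : model_ore q f g) * (X : model_ore q f g)
                * (model_poly q f g q%:P : model_ore q f g)).
rewrite -skew_hy_opM rmorphM -!mulrA; congr (_ * _).
exact/esym/(@model_scalarC F q f g q X).
Qed.

End ModelRelations.

(** Any solution x, y, h of the defining relations in an algebra B receives a
morphism from the model, obtained from the universal property of Ore
extensions at y first and at x next. *)
Section ModelEval.
Variables (F : fieldType) (q : F) (f g : {poly F}) (B : algType F) (x y h : B).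
Hypotheses (hx : h * x = x * horner_alg h f)
           (yh : y * h = horner_alg h f * y)
           (yx : y * x - q *: (x * y) = horner_alg h g).

(** The summand horner_alg h 0 is the contribution of the zero derivation: the
equation has the shape that the universal property of the extension by y
expects. *)
Lemma y_horner_alg p :
  y * horner_alg h p = horner_alg h (p \Po f) * y + horner_alg h 0.
Proof using yh.
rewrite rmorph0 addr0; elim/poly_ind: p => [|p c IH].
  by rewrite comp_poly0 rmorph0 mulr0 mul0r.
rewrite comp_poly_MXaddC !rmorphD !rmorphM /= !horner_algX !horner_algC.
rewrite mulrDr mulrDl mulr_algl mulr_algr; congr (_ + _).
by rewrite mulrA IH -!mulrA yh.
Qed.

Lemma horner_alg_x p : horner_alg h p * x = x * horner_alg h (p \Po f).
Proof using hx.
elim/poly_ind: p => [|p c IH]; first by rewrite comp_poly0 rmorph0 mulr0 mul0r.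
rewrite comp_poly_MXaddC !rmorphD !rmorphM /= !horner_algX !horner_algC.
rewrite mulrDr mulrDl mulr_algl mulr_algr; congr (_ + _).
by rewrite -mulrA hx !mulrA IH.
Qed.

Lemma yX_x k :
  y ^+ k * x = q ^+ k *: (x * y ^+ k) + horner_alg h (commut_coef q f g k) * y ^+ k.-1.
Proof using yh yx.
elim: k => [|k IH]; first by rewrite mul1r scale1r mulr1 rmorph0 mul0r addr0.
have yxE : y * x = q *: (x * y) + horner_alg h g by rewrite -yx addrC subrK.
rewrite [in LHS]exprS -mulrA IH mulrDr -scalerAr [y * (x * _)]mulrA yxE.
rewrite mulrDl scalerDr -scalerAl scalerA -exprSr -[x * y * _]mulrA -exprS.
rewrite -addrA; congr (_ + _); rewrite commut_coefS rmorphD mulrDl /=.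
rewrite linearZ /= mulr_algl -scalerAl; congr (_ + _).
rewrite mulrA y_horner_alg rmorph0 addr0 -mulrA.
by case: k {IH} => [|k]; rewrite ?comp_poly0 ?rmorph0 ?mul0r // exprS.
Qed.

Definition skew_hy_eval : skew_hy f -> B :=
  ore_eval (dM := skew_derivation0 (comp_hom f)) (horner_alg h) y.

Fact skew_hy_eval_is_zmod_morphism : {morph skew_hy_eval : u v / u - v}.
Proof using Type. exact: ore_eval_is_zmod_morphism. Qed.

Fact skew_hy_eval_is_monoid_morphism : monoid_morphism skew_hy_eval.
Proof using yh.
exact: (ore_eval_is_monoid_morphism (skew_derivation0 _) y_horner_alg).
Qed.

HB.instance Definition _ := GRing.isZmodMorphism.Build (skew_hy f) B
  skew_hy_eval skew_hy_eval_is_zmod_morphism.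
HB.instance Definition _ := GRing.isMonoidMorphism.Build (skew_hy f) B
  skew_hy_eval skew_hy_eval_is_monoid_morphism.

Lemma skew_hy_eval_wide n (u : skew_hy f) : (size (u : {poly {poly F}}) <= n)%N ->
  skew_hy_eval u = \sum_(k < n) horner_alg h (u : {poly {poly F}})`_k * y ^+ k.
Proof using Type. exact: ore_eval_wide. Qed.

(** The relation between x and the monomials p(h) y^k, given by yX_x, extends
additively to all of R. *)
Lemma skew_hy_eval_x (u : skew_hy f) :
  skew_hy_eval u * x = x * skew_hy_eval (twist q u) + skew_hy_eval (twist_der q g u).
Proof.
pose n := (size (u : {poly {poly F}})).+1.
rewrite (@skew_hy_eval_wide n u) ?leqnSn //.
rewrite (@skew_hy_eval_wide n (twist q u)); last first.
  exact: leq_trans (size_poly _ _) (leqnSn _).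
rewrite (@skew_hy_eval_wide n.-1 (twist_der q g u)) ?size_poly //.
rewrite mulr_suml mulr_sumr.
under eq_bigr do rewrite -mulrA yX_x mulrDr mulrA -scalerAr !mulrA horner_alg_x.
rewrite big_split; congr (_ + _).
  apply: eq_bigr => k _; rewrite coef_twist linearZ /=.
  by rewrite mulr_algl -scalerAl -scalerAr mulrA.
rewrite big_ord_recl /= rmorph0 mulr0 mul0r add0r.
by apply: eq_bigr => k _; rewrite coef_twist_der rmorphM.
Qed.

Let rho : {rmorphism (skew_hy f)^c -> B^c} := conv_morph skew_hy_eval.

Fact x_rho (u : (skew_hy f)^c) :
  (x : B^c) * rho u = rho (twist_op q u) * (x : B^c) + rho (twist_der_op q g u).
Proof. exact: skew_hy_eval_x. Qed.

Definition model_eval : model q f g -> B :=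
  ore_eval (dM := twist_op_derivation q g) rho (x : B^c).

Fact model_eval_is_zmod_morphism : {morph model_eval : u v / u - v}.
Proof.
exact: (@ore_eval_is_zmod_morphism _ _ _ (twist_op_derivation q g) _ rho x).
Qed.

Fact model_eval_is_monoid_morphism : monoid_morphism model_eval.
Proof.
have [E1 EM] := ore_eval_is_monoid_morphism (twist_op_derivation q g) x_rho.
by split=> // u v; apply: EM.
Qed.

Lemma model_eval_poly p : model_eval (model_poly q f g p) = horner_alg h p.
Proof.
rewrite [LHS](@ore_evalC _ _ _ (twist_op_derivation q g) _ rho x).
exact: (ore_evalC (skew_derivation0 (comp_hom f))).
Qed.

Fact model_eval_is_scalable : scalable model_eval.
Proof.
move=> k u; rewrite central_scaleE.
have [_ EM] := model_eval_is_monoid_morphism.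
by rewrite EM model_eval_poly horner_algC mulr_algl.
Qed.

HB.instance Definition _ := GRing.isZmodMorphism.Build (model q f g) B
  model_eval model_eval_is_zmod_morphism.
HB.instance Definition _ := GRing.isMonoidMorphism.Build (model q f g) B
  model_eval model_eval_is_monoid_morphism.
HB.instance Definition _ := GRing.isScalable.Build F (model q f g) B *:%R
  model_eval model_eval_is_scalable.

Lemma model_eval_x : model_eval (model_x q f g) = x.
Proof. exact: (@ore_evalX _ _ _ (twist_op_derivation q g) _ rho x). Qed.

Lemma model_eval_y : model_eval (model_y q f g) = y.
Proof.
rewrite [LHS](@ore_evalC _ _ _ (twist_op_derivation q g) _ rho x).
exact: (ore_evalX (skew_derivation0 (comp_hom f))).
Qed.

Lemma model_eval_h : model_eval (model_h q f g) = h.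
Proof. by rewrite model_eval_poly horner_algX. Qed.

Lemma model_lift :
  exists psi : {lrmorphism model q f g -> B},
    [/\ psi (model_x q f g) = x, psi (model_y q f g) = y
       & psi (model_h q f g) = h].
Proof.
exists (model_eval : {lrmorphism model q f g -> B}).
by split; [exact: model_eval_x | exact: model_eval_y | exact: model_eval_h].
Qed.

End ModelEval.

(** * Embedding in the model, and absence of zero divisors *)

(** The composite of the two morphisms given by the universal properties is an
endomorphism fixing the generators, hence the identity. *)
Lemma qgha_embeds_model (F : fieldType) (q : F) (f g : {poly F}) :
  exists phi : {lrmorphism qgha q f g -> model q f g},
    [/\ injective phi, phi (qgha_x q f g) = model_x q f g,
        phi (qgha_y q f g) = model_y q f g & phi (qgha_h q f g) = model_h q f g].
Proof.
have [phi [phix phiy phih]] :=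
  qgha_lift (model_hx q f g) (model_yh q f g) (model_yx q f g).
exists phi; split=> //.
have [psi [psix psiy psih]] :=
  model_lift (qgha_hx q f g) (qgha_yh q f g) (qgha_yx q f g).
have eval_unique := qgha_eval_unique (qgha_hx q f g) (qgha_yh q f g) (qgha_yx q f g).
have phiK : cancel phi psi.
  move=> u; apply: etrans (eval_unique (psi \o phi) _ _ _ u) _ => /=.
  - by rewrite phix psix.
  - by rewrite phiy psiy.
  - by rewrite phih psih.
  exact/esym/(eval_unique idfun).
exact: can_inj phiK.
Qed.

Lemma no_zero_divisors_is_domain (R : nzRingType) :
  no_zero_divisors R -> is_domain R.
Proof.
move=> R_dom; split=> [|a a0]; first exact: oner_neq0.
by split=> -[b b0] ab0; [have := R_dom a b a0 b0 | have := R_dom b a b0 a0];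
  rewrite ab0 eqxx.
Qed.

Lemma inj_no_zero_divisors (A B : nzRingType) (phi : {rmorphism A -> B}) :
  injective phi -> no_zero_divisors B -> no_zero_divisors A.
Proof.
move=> phi_inj B_dom a b a0 b0; rewrite -(raddf_eq0 _ phi_inj) /= rmorphM.
by apply: B_dom; rewrite raddf_eq0.
Qed.

Lemma converse_no_zero_divisors (A : nzRingType) :
  no_zero_divisors A -> no_zero_divisors A^c.
Proof. by move=> A_dom a b a0 b0; apply: A_dom. Qed.

(** Composition with a nonconstant f is injective, and the twist then is so
because it composes coefficients with f and scales them by powers of q. *)
Lemma model_no_zero_divisors (F : fieldType) (q : F) (f g : {poly F}) :
  q != 0 -> (1 < size f)%N -> no_zero_divisors (model q f g).
Proof.
move=> q0 f1.
have f_inj : injective (comp_poly f).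
  by apply: raddf_inj => p /eqP; rewrite comp_poly_eq0 // => /eqP.
apply: (@converse_no_zero_divisors (model_ore q f g)).
apply: ore_no_zero_divisors; last first.
  apply: converse_no_zero_divisors; apply: ore_no_zero_divisors => // a b.
  by rewrite mulf_eq0 negb_or => -> ->.
apply: raddf_inj => u u0; apply/polyP=> i; rewrite coef0.
have := congr1 (fun w : {poly {poly F}} => w`_i) u0.
rewrite coef0 coef_twist => /eqP.
by rewrite scaler_eq0 expf_eq0 (negPf q0) andbF comp_poly_eq0 // => /eqP.
Qed.

(** * Zero divisors in the excluded cases *)

(** The n+1 residues of 1, f, ..., f^n modulo g live in a space of dimension
n = deg g, so they are linearly dependent. *)
Lemma dvdp_comp_poly (F : fieldType) (f g : {poly F}) :
  g != 0 -> exists2 p : {poly F}, p != 0 & g %| p \Po f.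
Proof.
move=> g0; pose n := (size g).-1.
pose A : 'M[F]_(n.+1, n) := \matrix_(i < n.+1) poly_rV (f ^+ i %% g).
have rA : ~~ row_free A by rewrite -row_leq_rank -ltnNge ltnS rank_leq_col.
have [v vA v0] : exists2 v : 'rV_n.+1, v *m A = 0 & v != 0.
  have /rowV0Pn[v /sub_kermxP vA v0] : kermx A != 0 by rewrite kermx_eq0.
  by exists v.
exists (rVpoly v).
  apply: contraNneq v0 => /(congr1 (@poly_rV _ n.+1)).
  by rewrite rVpolyK linear0 => ->.
have sz_mod (p : {poly F}) : (size (p %% g)%R <= n)%N.
  by rewrite -ltnS prednK ?size_poly_gt0 ?ltn_modp.
rewrite /dvdp -[_ %% g](poly_rV_K (sz_mod _)).
suff -> : poly_rV ((rVpoly v \Po f) %% g) = v *m A by rewrite vA linear0.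
have modpZ_sum (m : nat) (c : 'I_m -> F) (P : 'I_m -> {poly F}) :
    (\sum_(i < m) c i *: P i) %% g = \sum_(i < m) c i *: (P i %% g).
  rewrite (big_morph (fun p : {poly F} => p %% g) (id1 := 0) (op1 := +%R)) ?mod0p //.
    by apply: eq_bigr => i _; rewrite modpZl.
  by move=> p r; rewrite modpD.
rewrite {1}[v]row_sum_delta !raddf_sum /=.
under eq_bigr do rewrite linearZ /= rVpoly_delta comp_polyZ comp_Xn_poly.
rewrite modpZ_sum raddf_sum mulmx_sum_row; apply: eq_bigr => i _.
by rewrite /= linearZ rowK.
Qed.

Lemma lrmorph_horner_alg (F : fieldType) (A B : algType F)
    (phi : {lrmorphism A -> B}) a p :
  phi (horner_alg a p) = horner_alg (phi a) p.
Proof.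
elim/poly_ind: p => [|p c IH]; first by rewrite !rmorph0.
by rewrite !rmorphD !rmorphM /= !horner_algX !horner_algC IH linearZ rmorph1.
Qed.

(** These computations use only the relations and the independence statement
h_free, which says that x B contains no nonzero polynomial in h. *)
Section LeftZeroDivisors.
Variables (F : fieldType) (f g : {poly F}) (B : algType F) (x y h : B).
Hypotheses (yh : y * h = horner_alg h f * y)
           (h_free : forall p w, horner_alg h p = x * w -> p = 0).

Lemma left_zero_divisor_of_constant : (size f <= 1)%N -> left_zero_divisor y.
Proof.
move=> /size1_polyC; move: f`_0 => c fc; exists (horner_alg h ('X - c%:P)).
  apply: contra_eq_neq (polyXsubC_eq0 c) => p0.
  by rewrite (@h_free ('X - c%:P) 0) ?eqxx ?mulr0.
rewrite (y_horner_alg yh) rmorph0 addr0 comp_polyB comp_polyX comp_polyC.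
by rewrite -fc subrr rmorph0 mul0r.
Qed.

Lemma left_zero_divisor_of_q0 : x != 0 ->
  y * x - 0 *: (x * y) = horner_alg h g -> left_zero_divisor y.
Proof.
rewrite scale0r subr0 => x0 yx; have [g0|g0] := eqVneq g 0.
  by exists x; rewrite // yx g0 rmorph0.
have [p p0 /dvdpP[r pf]] := dvdp_comp_poly f g0.
exists (x * (horner_alg h r * y) - horner_alg h p).
  by rewrite subr_eq0 eq_sym; apply: contra_neq p0 => /h_free.
rewrite mulrBr (y_horner_alg yh) rmorph0 addr0 pf !mulrA yx.
by rewrite mulrC rmorphM subrr.
Qed.

End LeftZeroDivisors.

Section ZeroDivisors.
Variables (F : fieldType) (q : F) (f g : {poly F}).

(** In the model x w is, read in the Ore extension, a polynomial multiple of the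
variable, so its constant coefficient vanishes, whereas p(h) is constant. *)
Lemma qgha_poly_eq_xM (p : {poly F}) (w : qgha q f g) :
  horner_alg (qgha_h q f g) p = qgha_x q f g * w -> p = 0.
Proof.
have [phi [_ phix phiy phih]] := qgha_embeds_model q f g.
move=> /(congr1 phi).
rewrite lrmorph_horner_alg phih horner_model_h rmorphM /= phix modelM.
move=> /(congr1 (fun u : model_ore q f g => (u : {poly (skew_hy f)^c})`_0)).
rewrite ore_mulrX coefMX /= coefC eqxx => p0.
by apply: (oreC_inj (dM := skew_derivation0 (comp_hom f))); rewrite p0 rmorph0.
Qed.

Lemma qgha_x_neq0 : qgha_x q f g != 0.
Proof.
have [phi [_ phix _ _]] := qgha_embeds_model q f g.
apply/eqP=> /(congr1 phi); rewrite phix raddf0 => /eqP.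
by rewrite [_ == 0]polyX_eq0.
Qed.

Lemma qgha_y_neq0 : qgha_y q f g != 0.
Proof.
have [phi [_ _ phiy _]] := qgha_embeds_model q f g.
apply/eqP=> /(congr1 phi); rewrite phiy raddf0 => /eqP.
by rewrite [_ == 0]polyC_eq0 [_ == 0]polyX_eq0.
Qed.

End ZeroDivisors.

Theorem proposition2p2 (F : fieldType) (q : F) (f g : {poly F}) :
  is_domain (qgha q f g) <-> q != 0 /\ (1 < size f)%N.
Proof.
split=> [[_ dom] | [q0 f1]].
  have [y_reg _] := dom _ (qgha_y_neq0 q f g).
  have h_free := @qgha_poly_eq_xM _ q f g.
  split; last first.
    rewrite ltnNge; apply/negP=> f1; apply: y_reg.
    exact: left_zero_divisor_of_constant (qgha_yh q f g) h_free f1.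
  apply/eqP=> q0; subst q; apply: y_reg.
  exact: left_zero_divisor_of_q0 (qgha_yh 0 f g) h_free
    (qgha_x_neq0 0 f g) (qgha_yx 0 f g).
have [phi [phi_inj _ _ _]] := qgha_embeds_model q f g.
apply: (@no_zero_divisors_is_domain (qgha q f g)).
exact: (@inj_no_zero_divisors _ (model q f g) phi) phi_inj
  (model_no_zero_divisors q0 f1).
Qed.
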